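(* Let $\{L_w : w\in W\}$ be a directed sufficient collection of subsignatures of $L_W$, let $T_W$ be an $L_W$-theory with reducts $T_w$ to $L_w$, and suppose all $T_w$, and therefore $T_W$, are simple (respectively, rosy). Let $n\in\omega$ and let $p$ be an $L_W$-type. If the $L_W$-Lascar rank of $p$ is at least $n$, then there is some $w_0\in W$ such that for all $w>w_0$ the $L_w$-Lascar rank of the reduct $p_w$ of $p$ to $L_w$ is at least $n$.
   Context: A collection $\{L_w : w\in W\}$ of subsignatures of $L_W$ is sufficient if every finite subsignature of $L_W$ is contained in some $L_w$; it is directed if, in addition, for all $u,v\in W$ there is $w\in W$ with $L_u\cup L_v\subset L_w$. $W$ is partially ordered by $u\le v$ iff $L_u\subset L_v$. The reduct of $T_W$ to $L_w$ is the set of all $L_w$-sentences that follow from $T_W$. The reduct $p_w$ is the set of $L_w$-formulas in $p$. The Lascar rank of a complete type is its foundation rank with respect to forking extensions (in the simple case), respectively thorn-forking extensions (in the rosy case), in the sense of the indicated signature. *)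

(* Defs.v *)
From Stdlib Require List.
From mathcomp Require Import all_boot.
From mathcomp Require Import boolp classical_sets functions cardinality.

Set Implicit Arguments.
Unset Strict Implicit.
Unset Printing Implicit Defensive.

Local Open Scope classical_set_scope.
Local Open Scope card_scope.

(** * Many-sorted first-order logic

    A context is a finite sequence of sorts; formulas are well-sorted and
    well-scoped by construction, with de Bruijn variables.  One-sorted logic is
    the case of a single sort; many sorts are needed for [M^eq]. *)

Record signature := Signature {
  sorts : Type;
  fsym : Type;
  rsym : Type;
  fdom : fsym -> seq sorts;
  fcod : fsym -> sorts;
  rdom : rsym -> seq sorts }.

Inductive var (S : Type) : seq S -> S -> Type :=
| vz s G : var (s :: G) s
| vs s t G : var G s -> var (t :: G) s.

Definition env S (car : S -> Type) (G : seq S) := forall s, var G s -> car s.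

Definition env_nil S (car : S -> Type) : env car [::] :=
  fun s x =>
    match x in var D t return (if D is [::] then car t else unit) with
    | vz _ _ => tt
    | vs _ _ _ _ => tt
    end.

Definition env_cons S (car : S -> Type) s G (a : car s) (v : env car G) :
    env car (s :: G) :=
  fun t x =>
    match x in var D t
      return (if D is s' :: G' then car s' -> env car G' -> car t else unit)
    with
    | vz _ _ => fun a' _ => a'
    | vs _ _ _ y => fun _ v' => v' _ y
    end a v.

Fixpoint env_cat S (car : S -> Type) G D :
    env car G -> env car D -> env car (G ++ D) :=
  match G with
  | [::] => fun _ v => v
  | s :: G' => fun u v =>
      env_cons (u s (vz s G')) (env_cat (fun t x => u t (vs s x)) v)
  end.

Definition env_single S (car : S -> Type) s (a : car s) : env car [:: s] :=
  env_cons a (@env_nil _ car).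

Fixpoint map_var S S' (h : S -> S') G s (x : var G s) : var (map h G) (h s) :=
  match x in var G s return var (map h G) (h s) with
  | vz s G => vz (h s) (map h G)
  | vs _ t _ y => vs (h t) (map_var h y)
  end.

Inductive term (L : signature) (G : seq (sorts L)) : sorts L -> Type :=
| Var s : var G s -> term G s
| App (f : fsym L) : (forall s, var (fdom f) s -> term G s) -> term G (fcod f).

Inductive formula (L : signature) : seq (sorts L) -> Type :=
| Bot G : formula G
| Eq G s : term G s -> term G s -> formula G
| Rel G (r : rsym L) : (forall s, var (rdom r) s -> term G s) -> formula G
| Imp G : formula G -> formula G -> formula G
| All G s : formula (s :: G) -> formula G.

Arguments Bot {L G}.

Definition Neg (L : signature) (G : seq (sorts L)) (phi : formula G) :=
  Imp phi Bot.

(** Carriers of structures, and the types standing for cardinals below, range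
    over one fixed universe: a cardinal of a smaller universe could never exceed
    the number of formulas, and there would be no monster models. *)
Definition universe := Type.

(** As usual, structures are nonempty (in every sort). *)
Record structure (L : signature) := Structure {
  car : sorts L -> universe;
  car_inh : forall s, inhabited (car s);
  fint : forall f : fsym L, env car (fdom f) -> car (fcod f);
  rint : forall r : rsym L, env car (rdom r) -> Prop }.

Arguments fint {L} M f v : rename.
Arguments rint {L} M r v : rename.

Definition menv (L : signature) (M : structure L) (G : seq (sorts L)) :=
  env (car M) G.

Fixpoint eval L (M : structure L) G (v : menv M G) s (t : term G s) : car M s :=
  match t with
  | Var _ x => v _ x
  | App f ts => fint M f (fun s x => eval v (ts s x))
  end.

Fixpoint sat L (M : structure L) G (phi : formula G) : menv M G -> Prop :=
  match phi with
  | Bot _ => fun _ => False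
  | Eq _ _ t u => fun v => eval v t = eval v u
  | Rel _ r ts => fun v => rint M r (fun s x => eval v (ts s x))
  | Imp _ p q => fun v => sat p v -> sat q v
  | All _ s p => fun v => forall a : car M s, sat p (env_cons a v)
  end.

Definition sentence (L : signature) := @formula L [::].

Definition theory (L : signature) := set (sentence L).

Definition holds L (M : structure L) (phi : sentence L) :=
  sat phi (@env_nil _ (car M)).

Definition models L (M : structure L) (T : theory L) :=
  forall phi, T phi -> holds M phi.

(** * Subsignatures and reducts

    Notions "in the sense of" a subsignature [S] of [L] are expressed inside
    [L]: an [S]-formula is an [L]-formula all of whose symbols and sorts lie in
    [S], and an [S]-structure is an [L]-structure in which only the [S]-formulas
    are looked at.  Nothing is lost: since all sorts are nonempty, every
    structure for the signature [S] expands to an [L]-structure. *)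

Definition ctx_in (L : signature) (P : set (sorts L)) (G : seq (sorts L)) :=
  forall s, var G s -> P s.

Record subsig (L : signature) := Subsig {
  in_sort : set (sorts L);
  in_fsym : set (fsym L);
  in_rsym : set (rsym L);
  fdom_closed : forall f, in_fsym f -> ctx_in in_sort (fdom f);
  fcod_closed : forall f, in_fsym f -> in_sort (fcod f);
  rdom_closed : forall r, in_rsym r -> ctx_in in_sort (rdom r) }.

Definition full (L : signature) : subsig L :=
  @Subsig L setT setT setT
    (fun _ _ _ _ => I) (fun _ _ => I) (fun _ _ _ _ => I).

Definition subsig_le (L : signature) (S S' : subsig L) :=
  [/\ in_sort S `<=` in_sort S', in_fsym S `<=` in_fsym S'
    & in_rsym S `<=` in_rsym S'].

Definition finite_subsig (L : signature) (S : subsig L) :=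
  [/\ finite_set (in_sort S), finite_set (in_fsym S) & finite_set (in_rsym S)].

Fixpoint term_in L (S : subsig L) G s (t : @term L G s) : Prop :=
  match t with
  | Var _ _ => True
  | App f ts => in_fsym S f /\ forall s x, term_in S (ts s x)
  end.

Fixpoint symbols_in L (S : subsig L) G (phi : @formula L G) : Prop :=
  match phi with
  | Bot _ => True
  | Eq _ _ t u => term_in S t /\ term_in S u
  | Rel _ r ts => in_rsym S r /\ forall s x, term_in S (ts s x)
  | Imp _ p q => symbols_in S p /\ symbols_in S q
  | All _ s p => in_sort S s /\ symbols_in S p
  end.

(* The free variables are required to have sorts in [S] as well. *)
Definition formula_in L (S : subsig L) G (phi : @formula L G) :=
  ctx_in (in_sort S) G /\ symbols_in S phi.

Definition all_formulas (L : signature) (S : subsig L) :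
    set {G : seq (sorts L) & formula G} :=
  [set phi | formula_in S (projT2 phi)].

Definition theory_reduct L (T : theory L) (S : subsig L) : theory L :=
  [set phi | formula_in S phi /\
             forall M : structure L, models M T -> holds M phi].

(** * Types *)

Definition params (L : signature) (M : structure L) :=
  set {s : sorts L & car M s}.

Definition env_range L (M : structure L) G (v : menv M G) : params M :=
  [set u | exists s (x : var G s), u = existT _ s (v s x)].

(** [PForm phi b] is the formula [phi(x, b)] in the variables [x] of sorts [X],
    with parameters [b] from [M]. *)
Record pformula (L : signature) (M : structure L) (X : seq (sorts L)) := PForm {
  pctx : seq (sorts L);
  pmat : formula (X ++ pctx);
  ppar : menv M pctx }.

Arguments ppar {L M X} p.

Definition realizes L (M : structure L) X (c : menv M X) (phi : pformula M X) :=
  sat (pmat phi) (env_cat c (ppar phi)).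

Definition pneg L (M : structure L) X (phi : pformula M X) : pformula M X :=
  PForm (Neg (pmat phi)) (ppar phi).

Definition pformula_in L (M : structure L) (S : subsig L) X
    (phi : pformula M X) :=
  formula_in S (pmat phi).

Definition pformula_over L (M : structure L) (A : params M) X
    (phi : pformula M X) :=
  env_range (ppar phi) `<=` A.

Definition ptype L (M : structure L) X := set (pformula M X).

Definition realizes_type L (M : structure L) X (c : menv M X) (p : ptype M X) :=
  forall phi, p phi -> realizes c phi.

Definition fin_satisfiable L (M : structure L) X (p : ptype M X) :=
  forall l : seq (pformula M X), (forall phi, List.In phi l -> p phi) ->
  exists c : menv M X, forall phi, List.In phi l -> realizes c phi.

(** [p] is a complete [S]-type over [A] (in [M]). *)
Definition complete_type L (M : structure L) (S : subsig L) (A : params M) X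
    (p : ptype M X) :=
  [/\ forall phi, p phi -> pformula_in S phi /\ pformula_over A phi,
      fin_satisfiable p
    & forall phi, pformula_in S phi -> pformula_over A phi ->
        p phi \/ p (pneg phi)].

(** [tp S A c] is the [S]-type of [c] over [A]. *)
Definition tp L (M : structure L) (S : subsig L) (A : params M) X
    (c : menv M X) : ptype M X :=
  [set phi | [/\ pformula_in S phi, pformula_over A phi & realizes c phi]].

Definition type_reduct L (M : structure L) X (p : ptype M X) (S : subsig L) :
    ptype M X :=
  [set phi | p phi /\ pformula_in S phi].

(** Monster models: [small K A] says that [A] has cardinality less than that of
    [K], and [monster S K M] that [M] is |K|-saturated as an [S]-structure, with
    |K| larger than the number of [S]-formulas.  All notions below are phrased
    in terms of types, so no homogeneity under automorphisms is required. *)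
Definition small (K : universe) L (M : structure L) (A : params M) :=
  ~~ ([set: K] #<= A).

Definition monster L (S : subsig L) (K : universe) (M : structure L) :=
  ~~ ([set: K] #<= all_formulas S) /\
  forall (A : params M) (s : sorts L) (p : ptype M [:: s]),
    small K A -> in_sort S s -> complete_type S A p ->
    exists a : car M s, realizes_type (env_single a) p.

(** * Forking and simplicity *)

Definition divides L (M : structure L) (S : subsig L) (A : params M) X
    (psi : pformula M X) :=
  pformula_in S psi /\
  exists (k : nat) (b : nat -> menv M (pctx psi)),
    (forall i, realizes_type (b i) (tp S A (ppar psi))) /\
    (forall i : 'I_k -> nat, injective i ->
      ~ exists c : menv M X, forall j, realizes c (PForm (pmat psi) (b (i j)))).

(** The definable set [P] is covered by finitely many instances of [dv]. *)
Definition fork_via L (M : structure L) X (dv : pformula M X -> Prop)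
    (P : set (menv M X)) :=
  exists l : seq (pformula M X),
    (forall psi, List.In psi l -> dv psi) /\
    (forall c, P c -> exists psi, List.In psi l /\ realizes c psi).

Definition forks L (M : structure L) (S : subsig L) (A : params M) X
    (phi : pformula M X) :=
  fork_via (@divides L M S A X) [set c | realizes c phi].

Definition tree_property L (M : structure L) X Y (phi : @formula L (X ++ Y)) :=
  exists (k : nat) (b : seq nat -> menv M Y),
    [/\ (1 < k)%N,
        forall (eta : seq nat) (i : 'I_k -> nat), injective i ->
          ~ exists c : menv M X, forall j,
              sat phi (env_cat c (b (rcons eta (i j))))
      & forall (sigma : nat -> nat) (n : nat),
          exists c : menv M X, forall m, (m < n)%N ->
              sat phi (env_cat c (b (mkseq sigma m.+1)))].

(** The [S]-theory [T] is simple: no formula has the tree property. *)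
Definition simple_theory L (S : subsig L) (T : theory L) :=
  forall M : structure L, models M T ->
  forall X Y (phi : @formula L (X ++ Y)), formula_in S phi ->
    ~ tree_property M phi.

(** * Imaginaries

    [L^eq] has the symbols of [L], and for every formula [E(x, x')] a sort and a
    projection onto it; an element of that sort in [M^eq] is a class
    [{a' | E(a, a')}].  Only those [E] that define equivalence relations are
    kept in the subsignature [eq_subsig M S], which is the signature of [M^eq]
    for the [S]-structure [M]. *)

Definition eq_formula (L : signature) := {G : seq (sorts L) & formula (G ++ G)}.

Definition eq_sig (L : signature) : signature := {|
  sorts := (sorts L + eq_formula L)%type;
  fsym := (fsym L + eq_formula L)%type;
  rsym := rsym L;
  fdom := fun f => match f with
                   | inl f => map inl (fdom f)
                   | inr E => map inl (projT1 E)
                   end;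
  fcod := fun f => match f with
                   | inl f => inl (fcod f)
                   | inr E => inr E
                   end;
  rdom := fun r => map inl (rdom r) |}.

Definition eq_rel L (M : structure L) (E : eq_formula L)
    (a a' : menv M (projT1 E)) : Prop :=
  sat (projT2 E) (env_cat a a').

Definition eq_class L (M : structure L) (E : eq_formula L) :=
  {C : set (menv M (projT1 E)) | exists a, C = eq_rel a}.

Definition proj_class L (M : structure L) (E : eq_formula L)
    (a : menv M (projT1 E)) : eq_class M E :=
  exist _ (eq_rel a) (ex_intro _ a erefl).

Definition eq_car L (M : structure L) (s : sorts (eq_sig L)) : universe :=
  match s with
  | inl s => car M s
  | inr E => eq_class M E
  end.

Lemma eq_car_inh L (M : structure L) (s : sorts (eq_sig L)) :
  inhabited (eq_car M s).
Proof.
case: s => [s|E] /=; first exact: car_inh.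
suff: inhabited (menv M (projT1 E)) by case=> a; split; exact: proj_class a.
elim: (projT1 E) => [|s G [v]]; first by split; exact: env_nil.
by case: (car_inh M s) => a; split; exact: env_cons a v.
Qed.

(** Restriction of an environment of real elements of [M^eq] to [M]. *)
Definition real_env L (M : structure L) (G : seq (sorts L))
    (v : env (@eq_car L M) (map inl G)) : menv M G :=
  fun s x => v (inl s) (map_var inl x).

Definition eq_structure L (M : structure L) : structure (eq_sig L) := {|
  car := @eq_car L M;
  car_inh := @eq_car_inh L M;
  fint := fun f =>
    match f return env (@eq_car L M) (@fdom (eq_sig L) f) ->
                   eq_car M (@fcod (eq_sig L) f) with
    | inl f => fun v => fint M f (real_env v)
    | inr E => fun v => proj_class (real_env v)
    end;
  rint := fun r v => rint M r (real_env v) |}.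

Definition is_equivalence T (R : T -> T -> Prop) :=
  [/\ forall a, R a a, forall a b, R a b -> R b a
    & forall a b c, R a b -> R b c -> R a c].

Definition eq_formula_in L (M : structure L) (S : subsig L)
    (E : eq_formula L) :=
  formula_in S (projT2 E) /\ is_equivalence (@eq_rel L M E).

Definition eq_in_sort L (M : structure L) (S : subsig L) :
    set (sorts (eq_sig L)) :=
  [set s | match s with inl s => in_sort S s | inr E => eq_formula_in M S E end].

Definition eq_in_fsym L (M : structure L) (S : subsig L) :
    set (fsym (eq_sig L)) :=
  [set f | match f with inl f => in_fsym S f | inr E => eq_formula_in M S E end].

Lemma ctx_in_map_inl L (M : structure L) (S : subsig L)
    (G : seq (sorts L)) :
  ctx_in (in_sort S) G -> @ctx_in (eq_sig L) (eq_in_sort M S) (map inl G).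
Proof.
elim: G => [|t G IH] HG s x; first by inversion x.
have Ht : eq_in_sort M S (inl t) := HG t (vz t G).
have HG' := IH (fun u y => HG u (vs t y)).
by inversion x; subst; [exact: Ht | apply: HG'].
Qed.

Lemma ctx_in_catl L (S : subsig L) (G D : seq (sorts L)) :
  ctx_in (in_sort S) (G ++ D) -> ctx_in (in_sort S) G.
Proof.
elim: G => [|t G IH] HG s x; first by inversion x.
have Ht : in_sort S t := HG t (vz t (G ++ D)).
have HG' := IH (fun u y => HG u (vs t y)).
by inversion x; subst; [exact: Ht | apply: HG'].
Qed.

Lemma eq_fdom_closed L (M : structure L) (S : subsig L) f :
  eq_in_fsym M S f -> ctx_in (eq_in_sort M S) (fdom f).
Proof.
case: f => [f|E] /= Hf; apply: ctx_in_map_inl; first exact: fdom_closed.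
by case: Hf => -[/ctx_in_catl].
Qed.

Lemma eq_fcod_closed L (M : structure L) (S : subsig L) f :
  eq_in_fsym M S f -> eq_in_sort M S (fcod f).
Proof. by case: f => [f|E] //=; exact: fcod_closed. Qed.

Lemma eq_rdom_closed L (M : structure L) (S : subsig L)
    (r : rsym (eq_sig L)) :
  in_rsym S r -> ctx_in (eq_in_sort M S) (rdom r).
Proof. by move=> Hr; apply: ctx_in_map_inl; exact: rdom_closed. Qed.

Definition eq_subsig L (M : structure L) (S : subsig L) :
    subsig (eq_sig L) :=
  @Subsig (eq_sig L) (eq_in_sort M S) (eq_in_fsym M S) (in_rsym S)
    (@eq_fdom_closed L M S) (@eq_fcod_closed L M S) (@eq_rdom_closed L M S).

Definition real_params L (M : structure L) (A : params M) :
    params (eq_structure M) :=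
  [set u | exists2 a, A a &
             u = existT (car (eq_structure M)) (inl (projT1 a)) (projT2 a)].

(** * Thorn-forking and rosiness

    These notions are to be used in [M^eq]. *)

Definition nonalgebraic L (M : structure L) X (p : ptype M X) :=
  forall phi, p phi -> infinite_set [set c | realizes c phi].

Definition strongly_divides L (M : structure L) (S : subsig L) (D : params M) X
    (psi : pformula M X) :=
  [/\ pformula_in S psi,
      nonalgebraic (tp S D (ppar psi))
    & exists k : nat, forall b : 'I_k -> menv M (pctx psi), injective b ->
        (forall i, realizes_type (b i) (tp S D (ppar psi))) ->
        ~ exists c : menv M X, forall i, realizes c (PForm (pmat psi) (b i))].

Definition thorn_divides L (M : structure L) (S : subsig L) (A : params M) X
    (psi : pformula M X) :=
  exists (Z : seq (sorts L)) (d : menv M Z),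
    ctx_in (in_sort S) Z /\ strongly_divides S (A `|` env_range d) psi.

(** A real formula thorn-forks over the real set [A]: in [M^eq] it implies a
    finite disjunction of formulas that thorn-divide over [A]. *)
Definition thorn_forks L (M : structure L) (S : subsig L) (A : params M) X
    (phi : pformula M X) :=
  fork_via
    (@thorn_divides _ (eq_structure M) (eq_subsig M S) (real_params A)
       (map inl X))
    [set c | realizes (real_env c) phi].

(** The [S]-theory [T] is rosy: thorn-forking has local character in [M^eq],
    i.e. the type of any finite tuple [c] over any small set [A] does not
    thorn-fork over some subset of [A] of size at most [|S| + aleph_0]. *)
Definition rosy_theory L (S : subsig L) (T : theory L) :=
  forall (K : universe) (M : structure L), models M T -> monster S K M ->
  let N := eq_structure M in
  let Seq := eq_subsig M S in
  forall (X : seq (sorts (eq_sig L))) (c : menv N X) (A : params N),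
    ctx_in (in_sort Seq) X -> small K A ->
    exists C : params N,
      [/\ C `<=` A, C #<= all_formulas S
        & forall phi, tp Seq A c phi ->
            ~ fork_via (@thorn_divides _ N Seq C X) [set c' | realizes c' phi]].

(** * Lascar rank *)

(** "The foundation rank of [x] is at least [n]", where [R x y] says that [y] is
    strictly below [x]. *)
Fixpoint rank_ge T (R : T -> T -> Prop) (n : nat) (x : T) : Prop :=
  if n is n'.+1 then exists y, R x y /\ rank_ge R n' y else True.

(** [(B, q)] is an extension of [(A, p)] to a complete [S]-type over a small
    set, containing a formula that forks over [A] in the sense of [fk]. *)
Definition forking_ext L (M : structure L) (S : subsig L) (K : universe) X
    (fk : params M -> pformula M X -> Prop) (Ap Bq : params M * ptype M X) :=
  let: (A, p) := Ap in let: (B, q) := Bq in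
  [/\ A `<=` B, small K B, complete_type S B q, p `<=` q
    & exists2 phi, q phi & fk A phi].

Definition lascar_rank_ge L (M : structure L) (S : subsig L) (K : universe) X
    (A : params M) (p : ptype M X) (n : nat) :=
  rank_ge (forking_ext S K (fun A phi => forks S A phi)) n (A, p).

Definition thorn_lascar_rank_ge L (M : structure L) (S : subsig L) (K : universe) X
    (A : params M) (p : ptype M X) (n : nat) :=
  rank_ge (forking_ext S K (fun A phi => thorn_forks S A phi)) n (A, p).

(** * Collections of subsignatures *)

Definition sufficient L (W : Type) (Lw : W -> subsig L) :=
  forall S : subsig L, finite_subsig S -> exists w, subsig_le S (Lw w).

Definition directed L (W : Type) (Lw : W -> subsig L) :=
  forall u v, exists w, subsig_le (Lw u) (Lw w) /\ subsig_le (Lw v) (Lw w).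

Definition index_lt L (W : Type) (Lw : W -> subsig L) (u v : W) :=
  subsig_le (Lw u) (Lw v) /\ u <> v.

(* Main.v *)
(* A formula that forks over [A] involves finitely many symbols, and so do the
   finitely many dividing formulas that it implies, so it still forks in every
   large enough subsignature: the sequences that witness dividing remain valid,
   since types only get weaker.  For thorn-dividing, weaker types are a problem:
   the k-inconsistency quantifies over all realizations of [tp(b/D)].  By
   compactness, in the form of saturation of the monster model transferred to
   its imaginaries, finitely many formulas of [tp(b/D)] already enforce
   k-inconsistency, and it suffices that the subsignature contains their
   symbols.  A rank of at least [n] is witnessed by a chain of [n] forking
   extensions, each of which restricts to large enough subsignatures. *)

Require Import Defs.
From mathcomp Require Import all_boot.
From mathcomp Require Import boolp classical_sets functions cardinality filter.

Set Implicit Arguments.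
Unset Strict Implicit.
Unset Printing Implicit Defensive.

Local Open Scope classical_set_scope.
Local Open Scope card_scope.

(** * Environments and substitution *)

Lemma env_ext S (car : S -> Type) (G : seq S) (v w : env car G) :
  (forall s x, v s x = w s x) -> v = w.
Proof.
by move=> vw; do 2! (apply: functional_extensionality_dep => ?); exact: vw.
Qed.

Lemma env_nilE S (car : S -> Type) (v w : env car [::]) : v = w.
Proof. by apply: env_ext => s x; inversion x. Qed.

(** Case analysis on a variable of a nonempty context. The return type of the [match] depends on the
    shape of the context, so no equation between dependent pairs of sorts arises. *)
Lemma var_cons_ind S (s : S) (G : seq S) (P : forall t, var (s :: G) t -> Prop) :
  P s (vz s G) -> (forall t y, P t (vs s y)) -> forall t x, P t x.
Proof.
move=> P0 PS t x.
refine (match x as x' in var D t' return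
   (if D is s' :: G' then fun x' : var (s' :: G') t' =>
      forall P : forall t, var (s' :: G') t -> Prop,
      P s' (vz s' G') -> (forall t y, P t (vs s' y)) -> P t' x'
    else fun _ => True) x' with
  | vz _ _ => fun _ H _ => H
  | vs _ _ _ y => fun _ _ H => H _ y end P P0 PS).
Qed.

Definition env_tail S (car : S -> Type) s (G : seq S) (v : env car (s :: G)) :
    env car G :=
  fun t x => v t (vs s x).

Lemma env_consE S (car : S -> Type) s (G : seq S) (v : env car (s :: G)) :
  v = env_cons (v s (vz s G)) (env_tail v).
Proof. by apply: env_ext; apply: var_cons_ind. Qed.

Fixpoint var_l S (G D : seq S) s (x : var G s) : var (G ++ D) s :=
  match x in var G s return var (G ++ D) s with
  | vz s G => vz s (G ++ D)
  | vs _ t _ y => vs t (var_l D y)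
  end.

Fixpoint var_r S (G D : seq S) s (x : var D s) : var (G ++ D) s :=
  match G with
  | [::] => x
  | t :: G' => vs t (var_r G' x)
  end.

Lemma env_cat_l S (car : S -> Type) (G D : seq S) (u : env car G)
    (v : env car D) s (x : var G s) :
  env_cat u v (var_l D x) = u s x.
Proof. by elim: x u => //= t s' G' y IH u; rewrite IH. Qed.

Lemma env_cat_r S (car : S -> Type) (G D : seq S) (u : env car G)
    (v : env car D) s (x : var D s) :
  env_cat u v (var_r G x) = v s x.
Proof. by elim: G u => //= t G IH u; exact: IH. Qed.

(** A renaming of [G] into [H] is itself an environment, with values in [var H]. Hence [env_cat] and
    [env_cons] also build renamings, and applying a renaming to an environment is composition. *)
Definition env_ren S (car : S -> Type) (G H : seq S) (v : env car H)
    (r : env (var H) G) : env car G :=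
  fun s x => v s (r s x).

Definition env_l S (G D : seq S) : env (var (G ++ D)) G :=
  fun s x => var_l D x.

Definition env_r S (G D : seq S) : env (var (G ++ D)) D :=
  fun s x => var_r G x.

Lemma env_ren_l S (car : S -> Type) (G D : seq S) (u : env car G)
    (v : env car D) :
  env_ren (env_cat u v) (@env_l S G D) = u.
Proof. by apply: env_ext => s x; exact: env_cat_l. Qed.

Lemma env_ren_r S (car : S -> Type) (G D : seq S) (u : env car G)
    (v : env car D) :
  env_ren (env_cat u v) (@env_r S G D) = v.
Proof. by apply: env_ext => s x; exact: env_cat_r. Qed.

Lemma env_ren_ren S (car : S -> Type) (G H I : seq S) (v : env car I)
    (r : env (var I) H) (r' : env (var H) G) :
  env_ren v (env_ren r r') = env_ren (env_ren v r) r'.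
Proof. by []. Qed.

Lemma env_ren_rr S (car : S -> Type) (G D H : seq S) (u : env car G)
    (v : env car D) (r : env (var D) H) :
  env_ren (env_cat u v) (env_ren (@env_r S G D) r) = env_ren v r.
Proof. by rewrite env_ren_ren env_ren_r. Qed.

Lemma env_cat_eta S (car : S -> Type) (G D : seq S) (w : env car (G ++ D)) :
  env_cat (env_ren w (@env_l S G D)) (env_ren w (@env_r S G D)) = w.
Proof.
elim: G w => [//|t G IH] w /=.
by rewrite [RHS]env_consE -(IH (env_tail w)).
Qed.

Lemma env_cat_map S (car car' : S -> Type) (h : forall s, car s -> car' s)
    (G D : seq S) (u : env car G) (v : env car D) :
  (fun s (x : var (G ++ D) s) => h s (env_cat u v x)) =
  env_cat (fun s x => h s (u s x)) (fun s x => h s (v s x)).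
Proof.
elim: G u => [//|t G IH] u /=.
by apply: env_ext; apply: var_cons_ind => //= s y; rewrite -IH.
Qed.

Lemma env_ren_cat S (car : S -> Type) (G D H : seq S) (w : env car H)
    (r : env (var H) G) (r' : env (var H) D) :
  env_ren w (env_cat r r') = env_cat (env_ren w r) (env_ren w r').
Proof. exact: (env_cat_map (fun s y => w s y)). Qed.

Lemma env_cat_ind S (car : S -> Type) (G D : seq S) (P : forall s, car s -> Prop)
    (u : env car G) (v : env car D) :
  (forall s x, P s (u s x)) -> (forall s x, P s (v s x)) ->
  forall s x, P s (env_cat u v (s := s) x).
Proof.
elim: G u => [//|t G IH] u /= Pu Pv.
by apply: var_cons_ind => [|s y]; [exact: Pu | apply: IH].
Qed.

(** * Renaming and simultaneous substitution in terms and formulas *)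

Fixpoint ren_term L (G H : seq (sorts L)) (r : env (var H) G) s
    (t : @term L G s) : @term L H s :=
  match t with
  | Var _ x => Var (r _ x)
  | App f ts => App (fun s x => ren_term r (ts s x))
  end.

Fixpoint subst_term L (G H : seq (sorts L)) (r : env (@term L H) G) s
    (t : @term L G s) : @term L H s :=
  match t with
  | Var _ x => r _ x
  | App f ts => App (fun s x => subst_term r (ts s x))
  end.

Definition lift_subst L (G H : seq (sorts L)) t (r : env (@term L H) G) :
    env (@term L (t :: H)) (t :: G) :=
  env_cons (Var (vz t H)) (fun s x => ren_term (fun _ y => vs t y) (r s x)).

Fixpoint subst L (G : seq (sorts L)) (phi : formula G) :
    forall H, env (@term L H) G -> formula H :=
  match phi with
  | Bot _ => fun _ _ => Bot
  | Eq _ _ t u => fun _ r => Eq (subst_term r t) (subst_term r u)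
  | Rel _ R ts => fun _ r => Rel (fun s x => subst_term r (ts s x))
  | Imp _ p q => fun _ r => Imp (subst p r) (subst q r)
  | All _ s p => fun _ r => All (subst p (lift_subst r))
  end.

Definition eval_env L (M : structure L) (G H : seq (sorts L)) (v : menv M H)
    (r : env (@term L H) G) : menv M G :=
  fun s x => eval v (r s x).

Lemma eval_ren L (M : structure L) (G H : seq (sorts L)) (r : env (var H) G)
    (v : menv M H) s (t : term G s) :
  eval v (ren_term r t) = eval (fun s x => v s (r s x)) t.
Proof.
elim: t => //= f ts IH; congr (fint M f _).
by apply: env_ext => s' x; exact: IH.
Qed.

Lemma eval_subst L (M : structure L) (G H : seq (sorts L))
    (r : env (@term L H) G) (v : menv M H) s (t : term G s) :
  eval v (subst_term r t) = eval (eval_env v r) t.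
Proof.
elim: t => //= f ts IH; congr (fint M f _).
by apply: env_ext => s' x; exact: IH.
Qed.

Lemma sat_subst L (M : structure L) (G : seq (sorts L)) (phi : formula G)
    (H : seq (sorts L)) (r : env (@term L H) G) (v : menv M H) :
  sat (subst phi r) v <-> sat phi (eval_env v r).
Proof.
elim: phi H r v => [D|D s t u|D R ts|D p IHp q IHq|D s p IH] H r v //=.
- by rewrite !eval_subst.
- suff -> : (fun s x => eval v (subst_term r (ts s x))) =
            (fun s x => eval (eval_env v r) (ts s x)) by [].
  by apply: env_ext => s x; rewrite eval_subst.
- by rewrite IHp IHq.
- have E a : eval_env (env_cons a v) (lift_subst r) =
             env_cons a (eval_env v r).
    apply: env_ext; apply: var_cons_ind => //= t y.
    by rewrite /eval_env /= eval_ren.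
  by split=> Hp a; move: (Hp a); rewrite IH E.
Qed.

Definition ren L (G H : seq (sorts L)) (r : env (var H) G) (phi : formula G) :
    @formula L H :=
  subst phi (fun s x => Var (r s x)).

Lemma sat_ren L (M : structure L) (G H : seq (sorts L)) (r : env (var H) G)
    (phi : formula G) (v : menv M H) :
  sat (ren r phi) v <-> sat phi (env_ren v r).
Proof. exact: sat_subst. Qed.

(** * Definable sets *)

(** Definability refers to all of [L]. The closure properties below allow a set to be recognized as
    definable from its description, without writing a formula for it. *)
Definition definable L (M : structure L) (D : params M) (G : seq (sorts L))
    (P : set (menv M G)) :=
  exists2 phi : pformula M G, pformula_over D phi &
    forall v, P v <-> realizes v phi.

(* Each coordinate of [f v] is a coordinate of [v] or a constant from [D]. *)
Definition coordinate_map L (M : structure L) (D : params M)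
    (G H : seq (sorts L)) (f : menv M G -> menv M H) :=
  forall s (x : var H s),
    (exists y : var G s, forall v, f v s x = v s y) \/
    (exists2 a : car M s, D (existT _ s a) & forall v, f v s x = a).

Lemma env_range_cat L (M : structure L) (D : params M) (G H : seq (sorts L))
    (u : menv M G) (v : menv M H) :
  env_range u `<=` D -> env_range v `<=` D -> env_range (env_cat u v) `<=` D.
Proof.
move=> uD vD w [s [x ->]]; move: s x.
apply: (env_cat_ind (P := fun s a => D (existT _ s a))) => s x.
  by apply: uD; exists s, x.
by apply: vD; exists s, x.
Qed.

Lemma env_range_nil L (M : structure L) (D : params M) (v : menv M [::]) :
  env_range v `<=` D.
Proof. by move=> u [s [x _]]; inversion x. Qed.

Lemma env_range_cons L (M : structure L) (D : params M) s (G : seq (sorts L))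
    (a : car M s) (v : menv M G) :
  D (existT _ s a) -> env_range v `<=` D -> env_range (env_cons a v) `<=` D.
Proof.
move=> Da vD w [t [x ->]]; move: t x.
by apply: var_cons_ind => //= t x; apply: vD; exists t, x.
Qed.

(** The constants used by the coordinates of [f] are collected in one tuple [b]; every coordinate of
    [f v] is then a coordinate of [v] followed by [b]. *)
Lemma coordinate_map_factor L (M : structure L) (D : params M)
    (G H : seq (sorts L)) (f : menv M G -> menv M H) :
  coordinate_map D f ->
  exists C (b : menv M C) (r : env (var (G ++ C)) H),
    env_range b `<=` D /\ forall v, f v = env_ren (env_cat v b) r.
Proof.
elim: H f => [|t H IH] f cf.
  exists [::], (@env_nil _ _), (@env_nil _ _); split; last first.
    by move=> v; exact: env_nilE.
  exact: env_range_nil.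
have [|C [b [r [bD fE]]]] := IH (fun v => env_tail (f v)).
  by move=> s x; exact: cf s (vs t x).
have [[y yE]|[a Da aE]] := cf t (vz t H).
  exists C, b, (env_cons (var_l C y) r); split=> // v.
  apply: env_ext; apply: var_cons_ind => [|s x] /=.
    by rewrite yE [RHS]env_cat_l.
  by transitivity (env_tail (f v) x) => //; rewrite fE.
(* The new constant [a] is put in front of [b], so the variables that [r] takes from [C] are shifted
   by one. *)
exists (t :: C), (env_cons a b), (env_cons (var_r G (vz t C))
  (env_ren (env_cat (@env_l _ _ _)
                    (env_ren (@env_r _ _ _) (fun s y => vs t y))) r)); split.
  exact: env_range_cons.
move=> v; apply: env_ext; apply: var_cons_ind => [|s x].
  by rewrite aE [RHS]env_cat_r.
transitivity (env_tail (f v) x) => //; rewrite fE.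
transitivity (env_ren (env_cat v (env_cons a b))
  (env_ren (env_cat (@env_l _ _ _)
   (env_ren (@env_r _ _ _) (fun s y => vs t y))) r) x) => //.
by rewrite env_ren_ren env_ren_cat env_ren_rr env_ren_l.
Qed.

Lemma eq_definable L (M : structure L) (D : params M) (G : seq (sorts L))
    (P Q : set (menv M G)) :
  (forall v, P v <-> Q v) -> definable D P -> definable D Q.
Proof. by move=> PQ [phi Dphi E]; exists phi => // v; rewrite -PQ. Qed.

Lemma definable_comp L (M : structure L) (D : params M) (G H : seq (sorts L))
    (f : menv M G -> menv M H) (P : set (menv M H)) :
  coordinate_map D f -> definable D P -> definable D (P \o f).
Proof.
move=> /coordinate_map_factor [C [b [r [bD fE]]]] [[E phi e] eD /= PE].
(* The parameters are now those of [f] followed by those of the formula: [r'] sends [H] along [r]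
   into [G] and [C], and [E] to the last block. *)
pose r' : env (var (G ++ (C ++ E))) (H ++ E) :=
  env_cat (env_ren (env_cat (@env_l _ _ _)
                            (env_ren (@env_r _ _ _) (@env_l _ _ _))) r)
          (env_ren (@env_r _ _ _) (@env_r _ _ _)).
exists (@PForm L M G (C ++ E) (ren r' phi) (env_cat b e)).
  exact: env_range_cat.
move=> v; rewrite /= PE /realizes /= sat_ren fE.
rewrite env_ren_cat env_ren_rr env_ren_r env_ren_ren env_ren_cat env_ren_rr.
by rewrite !env_ren_l.
Qed.

Lemma definable_sat L (M : structure L) (D : params M) (G : seq (sorts L))
    (phi : formula G) :
  definable D (fun v : menv M G => sat phi v).
Proof.
exists (@PForm L M G [::] (ren (@env_l _ _ _) phi) (@env_nil _ _)).
  exact: env_range_nil.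
by move=> v; rewrite /realizes /= sat_ren env_ren_l.
Qed.

Lemma definable_True L (M : structure L) (D : params M) (G : seq (sorts L)) :
  definable D (fun _ : menv M G => True).
Proof. by apply: eq_definable (definable_sat _ (Imp Bot Bot)) => v; split=> // _ [].
Qed.

Lemma definable_imp L (M : structure L) (D : params M) (G : seq (sorts L))
    (P Q : set (menv M G)) :
  definable D P -> definable D Q -> definable D (fun v => P v -> Q v).
Proof.
move=> [[B phi b] /= bD PE] [[C psi c] /= cD QE].
exists (@PForm L M G (B ++ C)
   (Imp (ren (env_cat (@env_l _ _ _) (env_ren (@env_r _ _ _) (@env_l _ _ _)))
             phi)
        (ren (env_cat (@env_l _ _ _) (env_ren (@env_r _ _ _) (@env_r _ _ _)))
             psi)) (env_cat b c)).
  exact: env_range_cat.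
move=> v; rewrite PE QE /realizes /= !sat_ren.
by rewrite !env_ren_cat !env_ren_rr !env_ren_l.
Qed.

Lemma definable_all L (M : structure L) (D : params M) s (G : seq (sorts L))
    (P : set (menv M (s :: G))) :
  definable D P -> definable D (fun v => forall a, P (env_cons a v)).
Proof.
move=> [[B phi b] /= bD PE]; exists (@PForm L M G B (All phi) b) => // v.
by split=> H a; [exact: (PE _).1 (H a) | exact: (PE (env_cons a v)).2 (H a)].
Qed.

Lemma definable_all_cat L (M : structure L) (D : params M)
    (H G : seq (sorts L)) (P : set (menv M (H ++ G))) :
  definable D P -> definable D (fun v => forall u, P (env_cat u v)).
Proof.
elim: H P => [|s H IH] P DP /=.
  by apply: eq_definable DP => v; split=> // /(_ (@env_nil _ _)).
apply: eq_definable (IH _ (definable_all DP)) => v; split=> Hv u.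
  by rewrite (env_consE u); exact: Hv.
by move=> a; exact: (Hv (env_cons a u)).
Qed.

Lemma definable_not L (M : structure L) (D : params M) (G : seq (sorts L))
    (P : set (menv M G)) :
  definable D P -> definable D (fun v => ~ P v).
Proof. by move=> DP; apply: definable_imp DP (definable_sat _ Bot). Qed.

Lemma definable_and L (M : structure L) (D : params M) (G : seq (sorts L))
    (P Q : set (menv M G)) :
  definable D P -> definable D Q -> definable D (fun v => P v /\ Q v).
Proof.
move=> DP DQ.
apply: eq_definable (definable_not (definable_imp DP (definable_not DQ))) => v.
by split=> [/not_implyP[Pv /contrapT]|[Pv Qv] /(_ Pv)].
Qed.

Lemma definable_ex_cat L (M : structure L) (D : params M)
    (H G : seq (sorts L)) (P : set (menv M (H ++ G))) :
  definable D P -> definable D (fun v => exists u, P (env_cat u v)).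
Proof.
move=> DP.
apply: eq_definable (definable_not (definable_all_cat (definable_not DP))) => v.
by split=> [/existsNP[u /contrapT Pu]|[u Pu] /(_ u)]; [exists u|].
Qed.

Lemma definable_all_In L (M : structure L) (D : params M) (G : seq (sorts L))
    J (F : J -> set (menv M G)) (l : seq J) :
  (forall j, definable D (F j)) ->
  definable D (fun v => forall j, List.In j l -> F j v).
Proof.
move=> DF; elim: l => [|j l IH].
  by apply: eq_definable (definable_True _ _) => v; split=> // _ j [].
apply: eq_definable (definable_and (DF j) IH) => v /=.
split=> [[Fj Fl] i [<- //|]|H]; first exact: Fl.
by split=> [|i il]; apply: H; [left | right].
Qed.

Lemma definable_all_var L (M : structure L) (D : params M) (G H : seq (sorts L))
    (F : forall s, var H s -> set (menv M G)) :
  (forall s x, definable D (F s x)) ->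
  definable D (fun v => forall s x, F s x v).
Proof.
elim: H F => [|t H IH] F DF.
  apply: eq_definable (definable_True _ _) => v; split=> // _ s x.
  by inversion x.
have := definable_and (DF t (vz t H)) (IH (fun s x => F s (vs t x)) _).
move=> /(_ (fun s x => DF s (vs t x))); apply: eq_definable => v.
by split=> [[Fz Fs]|Fv]; [exact: var_cons_ind | split].
Qed.

Lemma definable_all_ord L (M : structure L) (D : params M) (G : seq (sorts L))
    k (F : 'I_k -> set (menv M G)) :
  (forall i, definable D (F i)) -> definable D (fun v => forall i, F i v).
Proof.
elim: k F => [|k IH] F DF.
  by apply: eq_definable (definable_True _ _) => v; split=> // _ [].
have := definable_and (DF ord0) (IH (fun i => F (lift ord0 i)) _).
move=> /(_ (fun i => DF (lift ord0 i))); apply: eq_definable => v.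
by split=> [[F0 FS] i|Fv]; [case: (unliftP ord0 i) => [j|] -> | split].
Qed.

Lemma definable_param L (M : structure L) (D : params M) s (G : seq (sorts L))
    (a : car M s) (P : set (menv M (s :: G))) :
  definable D P ->
  definable (D `|` [set existT _ s a]) (fun v => P (env_cons a v)).
Proof.
move=> [[B phi b] /= bD PE].
have DP : definable (D `|` [set existT _ s a]) P.
  by exists (PForm phi b) => // u /bD; left.
apply: (definable_comp (f := fun v => env_cons a v) _ DP) => t.
move: t; apply: var_cons_ind => [|t x]; last by left; exists x.
by right; exists a => //; right.
Qed.

Lemma coordinate_map_ren L (M : structure L) (D : params M)
    (G H : seq (sorts L)) (r : env (var G) H) :
  coordinate_map D (fun v : menv M G => env_ren v r).
Proof. by move=> s x; left; exists (r s x). Qed.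

Lemma symbols_in_full L (G : seq (sorts L)) (phi : formula G) :
  symbols_in (full L) phi.
Proof.
have T G' s (t : @term L G' s) : term_in (full L) t by elim: t => /=.
by elim: phi => /=.
Qed.

Lemma formula_in_full L (G : seq (sorts L)) (phi : formula G) :
  formula_in (full L) phi.
Proof. by split=> //; exact: symbols_in_full. Qed.

(** * Saturation *)

Lemma card_le_inj T U (A : set T) (B : set U) (f : T -> U) :
  (forall x, A x -> B (f x)) -> set_inj A f -> A #<= B.
Proof.
move=> AB finj; have [g] : $|{injfun A >-> B}|.
  by apply/injfunPex; exists f.
exact: inj_card_le g.
Qed.

Lemma card_leT_ex T U (B : set U) :
  [set: T] #<= B -> exists2 f : T -> U, injective f & forall x, B (f x).
Proof.
move=> /card_leP[f].
exists (fun x => \val (f (to_setT x))) => [x y|x]; last exact: set_valP.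
move=> /val_inj /(@inj _ _ _ f _ _); rewrite !inE => /(_ I I).
by move/(congr1 val).
Qed.

(** Hilbert's hotel: if [g] takes the value [a] at [k0], precompose it with an injection of [K] into
    itself that avoids [k0]. *)
Lemma card_le_add1 K T (A : set T) a :
  infinite_set [set: K] -> [set: K] #<= A `|` [set a] -> [set: K] #<= A.
Proof.
move=> Kinf /card_leT_ex[g ginj gA].
have [[k0 gk0]|noa] := pselect (exists k, g k = a); last first.
  apply: (@card_le_inj _ _ _ _ g) => [x _|x y _ _ /ginj //].
  by have [//|gxa] := gA x; case: noa; exists x.
have /infiniteP/card_leT_ex[h hinj hk0] := infinite_setD Kinf (finite_set1 k0).
pose h' n := if n is m.+1 then h m else k0.
have h'inj : injective h'.
  case=> [|m] [|n] //= E; last by congr _.+1; exact: hinj.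
    by have [_ []] := hk0 n.
  by have [_ []] := hk0 m.
(* [h'] is an injective sequence starting at [k0]; [s] shifts along it and fixes all other points,
   so [k0] is not a value of [s]. *)
have /choice[s sE] : forall k, exists k',
    (exists2 n, k = h' n & k' = h' n.+1) \/ (~ range h' k /\ k' = k).
  move=> k.
  have [[n _ <-]|kh] := pselect (range h' k).
    by exists (h n); left; exists n.
  by exists k; right.
apply: (@card_le_inj _ _ _ _ (g \o s)) => [k _|k k' _ _ /= /ginj] /=.
  have [//|/= gsk] := gA (s k); exfalso; move: gsk; rewrite -gk0 => /ginj.
  have [[n _ ->] E|[kh ->] kk0] := sE k; last by apply: kh; exists 0.
  by have := h'inj n.+1 0 E.
have [[n -> ->]|[kh ->]] := sE k; have [[m -> ->]|[k'h ->]] := sE k' => //.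
- by move=> /h'inj[->].
- by move=> E; case: k'h; rewrite -E; exists n.+1.
- by move=> E; case: kh; rewrite E; exists m.+1.
Qed.

Fixpoint imp_depth L (G : seq (sorts L)) (phi : formula G) : nat :=
  if phi is Imp _ p _ then (imp_depth p).+1 else 0.

(** Even with no symbols at all, the iterated negations of [Bot] are infinitely many [S]-sentences,
    told apart by [imp_depth]; a [K] exceeding the number of formulas is therefore infinite. *)
Lemma monster_infinite L (S : subsig L) (K : universe) (M : structure L) :
  monster S K M -> infinite_set [set: K].
Proof.
move=> [KS _] Kfin; move/negP: KS; apply.
pose f n : {G : seq (sorts L) & formula G} :=
  existT _ [::] (iter n (@Neg L [::]) Bot).
have fS n : all_formulas S (f n).
  split; first by move=> s x; inversion x.
  by elim: n => //= n IH; split.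
have finj : injective f.
  have d n : imp_depth (projT2 (f n)) = n by elim: n => //= n ->.
  by move=> m n /(congr1 (fun u => imp_depth (projT2 u))); rewrite !d.
have Kn : [set: K] #<= [set: nat].
  have [n /card_eqPle[Kn _]] := Kfin.
  exact: card_le_trans Kn (card_leT _).
apply: card_le_trans Kn (card_le_inj (f := f) _ _) => // m n _ _.
exact: finj.
Qed.

Lemma small_add1 (K : universe) L (M : structure L) (A : params M) u :
  infinite_set [set: K] -> small K A -> small K (A `|` [set u]).
Proof. by move=> Kinf; apply: contraNN; exact: card_le_add1. Qed.

Lemma small_env_range (K : universe) L (M : structure L) (A : params M)
    (G : seq (sorts L)) (v : menv M G) :
  infinite_set [set: K] -> small K A -> small K (A `|` env_range v).
Proof.
move=> Kinf; elim: G v A => [|s G IH] v A Asmall.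
  suff -> : A `|` env_range v = A by [].
  by apply: setUidl; exact: env_range_nil.
suff -> : A `|` env_range v =
    (A `|` [set existT _ s (v s (vz s G))]) `|` env_range (env_tail v).
  by apply: IH; exact: small_add1.
rewrite -setUA; congr (A `|` _); apply/seteqP; split.
  move=> _ [t [x ->]]; move: t x; apply: var_cons_ind; first by left.
  by move=> t x; right; exists t, x.
by move=> _ [->|[t [x ->]]]; [exists s, (vz s G) | exists t, (vs s x)].
Qed.

(* Finitely satisfiable families generate a filter; the complete 1-types to
   realize are read off an ultrafilter extending it. *)
Lemma saturated (K : universe) L (M : structure L) (G : seq (sorts L)) J
    (D : params M) (F : J -> set (menv M G)) :
  monster (full L) K M -> small K D -> (forall j, definable D (F j)) ->
  (forall l : seq J, exists v, forall j, List.In j l -> F j v) ->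
  exists v, forall j, F j v.
Proof.
move=> MK; have Kinf := monster_infinite MK.
elim: G D F => [|s G IH] D F Dsmall DF Ffip.
  have [v _] := Ffip [::]; exists v => j.
  have [w Fw] := Ffip [:: j].
  by rewrite (env_nilE v w); apply: Fw; left.
pose B (l : seq J) := [set v | forall j, List.In j l -> F j v].
have FB : ProperFilter (filter_from setT B).
  apply: filter_from_proper => [|l _]; last exact: Ffip.
  apply: filter_from_filter; first by exists [::].
  move=> l l' _ _; exists (l ++ l') => // v Bv.
  by split=> j jl; apply: Bv; apply/List.in_app_iff; [left | right].
have [U [UU BU]] := ultraFilterLemma FB.
have PU : ProperFilter U := @ultra_proper _ _ UU.
have FU : Filter U := @filter_filter _ _ PU.
pose hd (v : menv M (s :: G)) : menv M [:: s] := env_single (v s (vz s G)).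
(* Saturation is given for single elements only, so the coordinates are found one by one: [p] is the
   limit along [U] of the types over [D] of the first coordinates. *)
pose p : ptype M [:: s] :=
  [set phi | pformula_over D phi /\ U [set v | realizes (hd v) phi]].
have pfin (l : seq (pformula M [:: s])) : (forall phi, List.In phi l -> p phi) ->
    U [set v | forall phi, List.In phi l -> realizes (hd v) phi].
  elim: l => [|phi l IHl] lp.
    by move: (@filterT _ U FU); apply: filterS => v _ phi [].
  have := @filterI _ U FU _ _ (lp phi (or_introl erefl)).2
    (IHl (fun psi H => lp psi (or_intror H))).
  by apply: filterS => v [vphi vl] psi [<- //|]; exact: vl.
have [|a pa] := MK.2 D s p Dsmall I.
  split=> [phi [Dphi _]||phi _ Dphi].
  - by split=> //; exact: formula_in_full.
  - by move=> l /pfin /filter_ex[v]; exists (hd v).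
  - have [Up|Up] := in_ultra_setVsetC [set v | realizes (hd v) phi] UU.
      by left.
    by right; split=> //; apply: filterS Up.
(* The realization [a] of [p] becomes a parameter, and the induction hypothesis supplies the other
   coordinates. *)
have [||v Fv] := IH (D `|` [set existT _ s a]) (fun j v => F j (env_cons a v))
  (small_add1 _ Kinf Dsmall).
- by move=> j; apply: definable_param.
- move=> l.
  (* [definable_ex_cat] quantifies an initial block, so [sw] moves the first variable to the end,
     where it stays free. *)
  pose sw : env (var (G ++ [:: s])) (s :: G) :=
    env_cons (var_r G (vz s [::])) (@env_l _ _ _).
  have := definable_ex_cat (definable_comp (coordinate_map_ren D sw)
     (definable_all_In l DF)).
  have swE w c : env_ren (env_cat w c) sw = env_cons (c s (vz s [::])) w.
    apply: env_ext; apply: var_cons_ind => [|t x] /=; first exact: env_cat_r.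
    exact: env_cat_l.
  (* [phi] says that the first coordinate extends to a point of [B l]. Since [B l] lies in [U],
     [phi] belongs to [p], and so [a] satisfies it. *)
  move=> [phi Dphi phiE]; have : realizes (env_single a) phi.
    apply: pa; split=> //.
    apply: filterS (BU _ (ex_intro2 _ _ l I (@subset_refl _ _))).
    move=> v Bv; apply/phiE; exists (env_tail v) => /= j jl.
    by rewrite swE /= -env_consE; exact: Bv.
  by move=> /phiE[v Fv]; exists v => j jl; have := Fv j jl; rewrite swE.
- by exists (env_cons a v).
Qed.

Lemma coordinate_map_comp_ren L (M : structure L) (D : params M)
    (G H I : seq (sorts L)) (f : menv M G -> menv M H) (r : env (var I) G) :
  coordinate_map D f -> coordinate_map D (fun v : menv M I => f (env_ren v r)).
Proof.
move=> Df s x; have [[y yE]|[a Da aE]] := Df s x; last by right; exists a.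
by left; exists (r s y) => v; rewrite yE.
Qed.

Lemma coordinate_map_cat L (M : structure L) (D : params M)
    (G H I : seq (sorts L)) (f : menv M G -> menv M H) (g : menv M G -> menv M I) :
  coordinate_map D f -> coordinate_map D g ->
  coordinate_map D (fun v => env_cat (f v) (g v)).
Proof.
elim: H f => [//|t H IH] f Df Dg s.
move: s; apply: var_cons_ind; first exact: Df t (vz t H).
by apply: (IH (fun v => env_tail (f v))) => // s x; exact: Df s (vs t x).
Qed.

(** * Translation of [L^eq] to [L] *)

(* A variable of sort [E] in [L^eq] becomes a block of real variables, standing
   for a representative of the class. *)
Definition real_sort L (s : sorts (eq_sig L)) : seq (sorts L) :=
  match s with inl s => [:: s] | inr E => projT1 E end.

Fixpoint real_ctx L (G : seq (sorts (eq_sig L))) : seq (sorts L) :=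
  if G is s :: G' then real_sort s ++ real_ctx G' else [::].

Fixpoint block L (G : seq (sorts (eq_sig L))) s (x : var G s) :
    env (var (real_ctx G)) (real_sort s) :=
  match x in var G s return env (var (real_ctx G)) (real_sort s) with
  | vz s G => @env_l _ (real_sort s) (real_ctx G)
  | vs _ t G y => env_ren (@env_r _ (real_sort t) (real_ctx G)) (block y)
  end.

Definition proj_elt L (M : structure L) (s : sorts (eq_sig L)) :
    menv M (real_sort s) -> car (eq_structure M) s :=
  match s with
  | inl s => fun v => v s (vz s [::])
  | inr E => fun v => proj_class v
  end.

Definition proj_env L (M : structure L) (G : seq (sorts (eq_sig L)))
    (v : menv M (real_ctx G)) : menv (eq_structure M) G :=
  fun s x => proj_elt (env_ren v (block x)).

Lemma proj_elt_surj L (M : structure L) s (a : car (eq_structure M) s) :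
  exists v : menv M (real_sort s), proj_elt v = a.
Proof.
case: s a => [s a|E [C Cv]]; first by exists (@env_single _ (car M) s a).
by have [v CE] := Cv; exists v; exact/eq_exist/esym.
Qed.

Lemma proj_env_cons L (M : structure L) s (G : seq (sorts (eq_sig L)))
    (u : menv M (real_sort s)) (v : menv M (real_ctx G)) :
  proj_env (G := s :: G) (env_cat u v) = env_cons (proj_elt u) (proj_env v).
Proof.
apply: env_ext; apply: var_cons_ind => [|t y]; rewrite /proj_env /=.
  by rewrite env_ren_l.
by rewrite env_ren_rr.
Qed.

(** Every formula [E] has a sort in [eq_sig], whether or not it defines an equivalence relation.
    Equality of classes is therefore expressed as equality of the two sets, with a quantifier over
    [x], rather than as [E(a, b)]. *)
Lemma proj_class_eq L (M : structure L) (E : eq_formula L)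
    (a b : menv M (projT1 E)) :
  proj_class a = proj_class b <->
  forall x : menv M (projT1 E),
    sat (projT2 E) (env_cat a x) <-> sat (projT2 E) (env_cat b x).
Proof.
split=> [[ab] x|ab].
  by move/(congr1 (fun C => C x)): ab; rewrite /eq_rel => ->.
by apply: eq_exist; apply/funext => x; apply/propext; exact: ab.
Qed.

(** A term is translated to a tuple of terms for a representative of its value. Arguments of symbols
    have real sorts, hence one component each, and the projection to [E] simply becomes the tuple of
    its arguments. *)
Fixpoint real_term L (G : seq (sorts (eq_sig L))) s (t : @term (eq_sig L) G s) :
    env (@term L (real_ctx G)) (real_sort s) :=
  match t in term _ s return env (@term L (real_ctx G)) (real_sort s) with
  | Var _ x => fun _ y => Var (block x y)
  | App f ts =>
    match f return
      (forall s, var (@fdom (eq_sig L) f) s ->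
         env (@term L (real_ctx G)) (real_sort s)) ->
      env (@term L (real_ctx G)) (real_sort (@fcod (eq_sig L) f))
    with
    | inl f => fun us =>
        env_single (App (fun s x => us (inl s) (map_var inl x) s (vz s [::])))
    | inr E => fun us => fun s x => us (inl s) (map_var inl x) s (vz s [::])
    end (fun s x => real_term (ts s x))
  end.

Lemma eval_real_term L (M : structure L) (G : seq (sorts (eq_sig L))) s
    (t : term G s) (v : menv M (real_ctx G)) :
  proj_elt (eval_env v (real_term t)) = eval (proj_env v) t.
Proof.
elim: t => [s' x|f ts IH] //; case: f ts IH => [f|E] ts IH /=.
  congr (fint M f _); apply: env_ext => s' x.
  exact: (IH (inl s') (map_var inl x)).
congr proj_class; apply: env_ext => s' x.
exact: (IH (inl s') (map_var inl x)).
Qed.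

Lemma definable_iff L (M : structure L) (D : params M) (G : seq (sorts L))
    (P Q : set (menv M G)) :
  definable D P -> definable D Q -> definable D (fun v => P v <-> Q v).
Proof. by move=> DP DQ; apply: definable_and; apply: definable_imp. Qed.

(** By induction on [phi]: since [proj_elt] is surjective, a quantifier over a sort of [M^eq]
    becomes a block of quantifiers over representatives. Equality at an imaginary sort is the case
    that needs [proj_class_eq]. *)
Lemma definable_real L (M : structure L) (D : params M)
    (G : seq (sorts (eq_sig L))) (phi : formula G) :
  definable D
    (fun v : menv M (real_ctx G) => sat (M := eq_structure M) phi (proj_env v)).
Proof.
elim: phi => {}G.
- exact: (definable_sat _ Bot).
- case=> [s|E] t u.
    apply: eq_definable (definable_sat _
      (Eq (real_term t (vz s [::])) (real_term u (vz s [::])))) => v /=.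
    by rewrite -!eval_real_term.
  (* [E' w] is the formula [E(w, x)] with [x] a fresh initial block; equality of [t] and [u] becomes
     equivalence of [E' t] and [E' u] for all [x]. *)
  pose E' (w : term G (inr E)) : @formula L (projT1 E ++ real_ctx G) :=
    subst (projT2 E)
      (env_cat (fun s x => ren_term (@env_r _ _ _) (real_term w x))
               (fun s x => Var (@env_l _ _ _ s x))).
  have E'P (w : term G (inr E)) v x : sat (E' w) (env_cat x v) <->
      sat (projT2 E) (env_cat (eval_env (M := M) v (real_term w)) x).
    rewrite sat_subst /eval_env.
    rewrite (env_cat_map (fun s (t : term _ s) => eval (env_cat x v) t)).
    suff -> : (fun s y => eval (env_cat x v) (ren_term (@env_r _ _ _)
        (real_term w y))) = eval_env v (real_term w).
      suff -> : (fun s y => eval (env_cat x v) (Var (@env_l _ _ _ s y))) = x by [].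
      exact: env_ren_l.
    apply: env_ext => s y; rewrite eval_ren.
    by rewrite -[X in eval X _]/(env_ren _ _) env_ren_r.
  apply: eq_definable (definable_all_cat (definable_iff
    (definable_sat D (E' t)) (definable_sat D (E' u)))) => v /=.
  rewrite -!eval_real_term [_ = _]proj_class_eq.
  by split=> H x; move: (H x); rewrite !E'P.
- move=> R ts.
  apply: eq_definable (definable_sat _
    (Rel (fun s x => real_term (ts (inl s) (map_var inl x)) (vz s [::])))) => v /=.
  suff -> : real_env (fun s x => eval (M := eq_structure M) (proj_env v) (ts s x))
    = (fun s x => eval v (real_term (ts (inl s) (map_var inl x)) (vz s [::]))).
    by [].
  by apply: env_ext => s x; rewrite /real_env -eval_real_term.
- by move=> p IHp q IHq; exact: definable_imp.
- move=> s p IH; apply: eq_definable (definable_all_cat IH) => v /=.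
  split=> H; last by move=> u; rewrite proj_env_cons; exact: H.
  by move=> a; have [u <-] := proj_elt_surj a; rewrite -proj_env_cons; exact: H.
Qed.

(** This lets a small real set [D] stand in for a set [D'] of imaginary parameters. *)
Definition represents L (M : structure L) (D : params M)
    (D' : params (eq_structure M)) :=
  forall u, D' u ->
    exists2 v : menv M (real_sort (projT1 u)),
      proj_elt v = projT2 u & env_range v `<=` D.

Lemma proj_env_lift L (M : structure L) (D : params M)
    (D' : params (eq_structure M)) (G : seq (sorts (eq_sig L)))
    (e : menv (eq_structure M) G) :
  represents D D' ->
  env_range e `<=` D' ->
  exists2 v : menv M (real_ctx G), proj_env v = e & env_range v `<=` D.
Proof.
move=> D'D; elim: G e => [|s G IH] e eD'.
  by exists (@env_nil _ _); [exact: env_nilE | exact: env_range_nil].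
have [|v vE vD] := IH (env_tail e).
  by move=> _ [t [x ->]]; apply: eD'; exists t, (vs s x).
have [|u uE uD] := D'D (existT _ s (e s (vz s G))).
  by apply: eD'; exists s, (vz s G).
exists (env_cat u v); last exact: env_range_cat.
by rewrite proj_env_cons uE vE -env_consE.
Qed.

Lemma proj_env_surj L (M : structure L) (G : seq (sorts (eq_sig L)))
    (e : menv (eq_structure M) G) :
  exists v : menv M (real_ctx G), proj_env v = e.
Proof.
have [|v] := @proj_env_lift _ _ setT setT _ e _ (@subsetT _ _); last by exists v.
by move=> [s a] _; have [v] := proj_elt_surj a; exists v.
Qed.

(** The contexts [real_ctx (G ++ C)] and [real_ctx G ++ real_ctx C] are not convertible, so
    representatives of parameters are appended by a map built along [G]. As a coordinate map it
    pulls definable sets back to definable sets. *)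
Lemma proj_env_cat L (M : structure L) (D : params M)
    (G C : seq (sorts (eq_sig L))) (b : menv M (real_ctx C)) :
  env_range b `<=` D ->
  exists2 f : menv M (real_ctx G) -> menv M (real_ctx (G ++ C)),
    coordinate_map D f &
    forall v, proj_env (f v) = env_cat (proj_env v) (proj_env b).
Proof.
move=> bD; elim: G => [|s G [f fD fE]].
  exists (fun _ => b) => // s x; right; exists (b s x) => //.
  by apply: bD; exists s, x.
exists (fun v => env_cat (env_ren v (@env_l _ (real_sort s) (real_ctx G)))
                         (f (env_ren v (@env_r _ (real_sort s) (real_ctx G))))).
  apply: coordinate_map_cat; first exact: coordinate_map_ren.
  exact: coordinate_map_comp_ren.
move=> v; rewrite proj_env_cons fE.
by rewrite -[v in RHS]env_cat_eta proj_env_cons.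
Qed.

(** The family is pulled back along [proj_env]: the preimages are definable over [D], and
    surjectivity keeps them finitely satisfiable. *)
Lemma eq_saturated (K : universe) L (M : structure L) (D : params M)
    (D' : params (eq_structure M)) (G : seq (sorts (eq_sig L))) J
    (F : J -> set (menv (eq_structure M) G)) :
  monster (full L) K M -> small K D ->
  represents D D' ->
  (forall j, definable D' (F j)) ->
  (forall l : seq J, exists v, forall j, List.In j l -> F j v) ->
  exists v, forall j, F j v.
Proof.
move=> MK Dsmall D'D D'F Ffip.
have [||v Fv] := saturated (F := fun j v => F j (proj_env v)) MK Dsmall.
- move=> j; have [[C phi b] bD' /= FE] := D'F j.
  have [c cb cD] := proj_env_lift D'D bD'.
  have [f fD fE] := @proj_env_cat _ _ _ G _ _ cD.
  apply: eq_definable (definable_comp fD (definable_real D phi)) => v /=.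
  by rewrite FE /realizes /= fE cb.
- move=> l; have [e Fe] := Ffip l.
  by have [v vE] := proj_env_surj e; exists v; rewrite vE.
- by exists (proj_env v).
Qed.

(** * Properties of all large enough subsignatures *)

(** Membership in the filter generated by the cones above finite subsignatures; finitely many
    conditions can thus be imposed one at a time. *)
Definition for_large L (P : subsig L -> Prop) :=
  exists2 S0, finite_subsig S0 & forall S, subsig_le S0 S -> P S.

Lemma for_large_mono L (P Q : subsig L -> Prop) :
  (forall S, P S -> Q S) -> for_large P -> for_large Q.
Proof. by move=> PQ [S0 S0fin PS]; exists S0 => // S /PS /PQ. Qed.

Lemma for_largeT L (P : subsig L -> Prop) : (forall S, P S) -> for_large P.
Proof.
move=> PT; exists (@Subsig L set0 set0 set0 (fun _ H => match H with end)
  (fun _ H => match H with end) (fun _ H => match H with end)) => //.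
Qed.

Lemma for_large_and L (P Q : subsig L -> Prop) :
  for_large P -> for_large Q -> for_large (fun S => P S /\ Q S).
Proof.
move=> [S [S1 S2 S3] PS] [T [T1 T2 T3] QT].
have fd f : (in_fsym S `|` in_fsym T) f ->
    ctx_in (in_sort S `|` in_sort T) (fdom f).
  by move=> [] Hf s x; [left | right]; exact: fdom_closed x.
have fc f : (in_fsym S `|` in_fsym T) f -> (in_sort S `|` in_sort T) (fcod f).
  by move=> [] Hf; [left | right]; exact: fcod_closed.
have rd r : (in_rsym S `|` in_rsym T) r ->
    ctx_in (in_sort S `|` in_sort T) (rdom r).
  by move=> [] Hr s x; [left | right]; exact: rdom_closed x.
exists (Subsig fd fc rd); first by split; rewrite /= finite_setU.
move=> U [/= U1 U2 U3].
by split; [apply: PS | apply: QT]; split=> x Hx;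
  [apply: U1 | apply: U2 | apply: U3 | apply: U1 | apply: U2 | apply: U3];
  [left | left | left | right | right | right].
Qed.

Lemma for_large_In L J (Q : J -> subsig L -> Prop) (l : seq J) :
  (forall j, List.In j l -> for_large (Q j)) ->
  for_large (fun S => forall j, List.In j l -> Q j S).
Proof.
elim: l => [|j l IH] Ql; first exact: for_largeT.
have H := for_large_and (Ql j (or_introl erefl))
  (IH (fun i il => Ql i (or_intror il))).
by apply: for_large_mono H => S [Qj QS] i [<- //|]; exact: QS.
Qed.

Lemma for_large_var L T (G : seq T) (Q : forall s, var G s -> subsig L -> Prop) :
  (forall s x, for_large (Q s x)) ->
  for_large (fun S => forall s x, Q s x S).
Proof.
elim: G Q => [|t G IH] Q QG.
  by apply: for_largeT => S s x; inversion x.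
have H := for_large_and (QG t (vz t G)) (IH _ (fun s x => QG s (vs t x))).
by apply: for_large_mono H => S [Qz Qs]; exact: var_cons_ind.
Qed.

Lemma finite_ctx T (G : seq T) : finite_set [set s | inhabited (var G s)].
Proof.
elim: G => [|t G IH].
  rewrite (_ : [set s | _] = set0); first exact: finite_set0.
  by apply/seteqP; split=> // s [x]; inversion x.
apply: (@sub_finite_set _ _ ([set t] `|` [set s | inhabited (var G s)])).
  move=> s [x]; move: s x; apply: var_cons_ind; first by left.
  by move=> s x; right; split.
by rewrite finite_setU; split=> //; exact: finite_set1.
Qed.

Lemma for_large_sort L (s : sorts L) : for_large (fun S => in_sort S s).
Proof.
exists (@Subsig L [set s] set0 set0 (fun _ H => match H with end)
  (fun _ H => match H with end) (fun _ H => match H with end)).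
  by split; [exact: finite_set1 | exact: finite_set0 | exact: finite_set0].
by move=> S [Ss _ _]; exact: Ss.
Qed.

Lemma for_large_fsym L (f : Defs.fsym L) : for_large (fun S => in_fsym S f).
Proof.
(* A subsignature with [f] must also contain the sorts of its arguments and of its value;
   [inhabited (var G s)] says that [s] occurs in [G]. *)
pose B := [set s | inhabited (var (fdom f) s)] `|` [set fcod f].
have fd g : [set f] g -> ctx_in B (fdom g) by move=> -> s x; left; split.
have fc g : [set f] g -> B (fcod g) by move=> ->; right.
exists (@Subsig L B [set f] set0 fd fc (fun _ H => match H with end)).
  split; [|exact: finite_set1 | exact: finite_set0].
  by rewrite finite_setU; split; [exact: finite_ctx | exact: finite_set1].
by move=> S [_ Sf _]; exact: Sf.
Qed.

Lemma for_large_rsym L (r : rsym L) : for_large (fun S => in_rsym S r).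
Proof.
have rd R : [set r] R -> ctx_in [set s | inhabited (var (rdom r) s)] (rdom R).
  by move=> -> s x; split.
exists (@Subsig L [set s | inhabited (var (rdom r) s)] set0 [set r]
  (fun _ H => match H with end) (fun _ H => match H with end) rd).
  by split; [exact: finite_ctx | exact: finite_set0 | exact: finite_set1].
by move=> S [_ _ Sr]; exact: Sr.
Qed.

(* Covers both [S |-> S] and [S |-> eq_subsig M S]. *)
Definition finitary L L' (E : subsig L -> subsig L') :=
  [/\ forall s, in_sort (E (full L)) s -> for_large (fun S => in_sort (E S) s),
      forall f, in_fsym (E (full L)) f -> for_large (fun S => in_fsym (E S) f)
    & forall r, in_rsym (E (full L)) r -> for_large (fun S => in_rsym (E S) r)].

Lemma for_large_ctx_in L L' (E : subsig L -> subsig L') (G : seq (sorts L')) :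
  finitary E -> ctx_in (in_sort (E (full L))) G ->
  for_large (fun S => ctx_in (in_sort (E S)) G).
Proof. by move=> [Es _ _] GE; apply: for_large_var => s x; exact/Es/GE. Qed.

Lemma for_large_term_in L L' (E : subsig L -> subsig L') (G : seq (sorts L')) s
    (t : term G s) :
  finitary E -> term_in (E (full L)) t ->
  for_large (fun S => term_in (E S) t).
Proof.
move=> [_ Ef _]; elim: t => [s' x|f ts IH] /=.
  by move=> _; exact: for_largeT.
move=> [/Ef Hf Hts]; apply: for_large_and Hf _.
by apply: for_large_var => s' x; exact/IH/Hts.
Qed.

Lemma for_large_formula_in L L' (E : subsig L -> subsig L') (G : seq (sorts L'))
    (phi : formula G) :
  finitary E -> formula_in (E (full L)) phi ->
  for_large (fun S => formula_in (E S) phi).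
Proof.
move=> Efin [GE phiE]; apply: for_large_and (for_large_ctx_in Efin GE) _.
elim: phi phiE {GE} => [D|D s t u|D r ts|D p IHp q IHq|D s p IH] /=.
- by move=> _; exact: for_largeT.
- by move=> [tE uE]; apply: for_large_and; exact: for_large_term_in.
- move=> [rE tsE]; apply: for_large_and; first by case: Efin => _ _; exact.
  by apply: for_large_var => s x; exact: for_large_term_in.
- by move=> [pE qE]; apply: for_large_and; [exact: IHp | exact: IHq].
- move=> [sE pE]; apply: for_large_and; last exact: IH.
  by case: Efin => Es _ _; exact: Es.
Qed.

Lemma finitary_id L : finitary (fun S : subsig L => S).
Proof.
by split=> x _;
  [exact: for_large_sort | exact: for_large_fsym | exact: for_large_rsym].
Qed.

(** That [E] defines an equivalence relation depends on [M] alone, so [E] belongs to [eq_subsig M S]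
    as soon as [S] has the symbols and sorts of [E]. *)
Lemma finitary_eq_subsig L (M : structure L) : finitary (eq_subsig M).
Proof.
have EF (E : eq_formula L) : eq_formula_in M (full L) E ->
    for_large (fun S => eq_formula_in M S E).
  move=> [_ Eeq]; have H := for_large_formula_in (finitary_id L)
    (formula_in_full (projT2 E)).
  exact: for_large_mono H.
split=> [[s|E]|[f|E]|r] //=.
- by move=> _; exact: for_large_sort.
- by move=> /EF.
- by move=> _; exact: for_large_fsym.
- by move=> /EF.
- by move=> _; exact: for_large_rsym.
Qed.

(** * Types and forking under change of subsignature *)

Lemma formula_in_le L (S S' : subsig L) (G : seq (sorts L)) (phi : formula G) :
  subsig_le S S' -> formula_in S phi -> formula_in S' phi.
Proof.
move=> [Ss Sf Sr] [GS phiS]; split; first by move=> s x; exact/Ss/GS.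
have T D s (t : @term L D s) : term_in S t -> term_in S' t.
  elim: t => //= f ts IH [/Sf fS tsS]; split=> // s' x; exact/IH/tsS.
elim: phi phiS {GS} => [D|D s t u|D r ts|D p IHp q IHq|D s p IH] //=.
- by move=> [/T tS /T uS].
- by move=> [/Sr rS tsS]; split=> // s x; exact/T/tsS.
- by move=> [/IHp pS /IHq qS].
- by move=> [/Ss sS /IH pS].
Qed.

Lemma eq_subsig_full L (M : structure L) (S : subsig L) :
  subsig_le (eq_subsig M S) (eq_subsig M (full L)).
Proof.
split=> [[s|E]|[f|E]|r] //= [_ Eeq]; split=> //; exact: formula_in_full.
Qed.

Lemma full_max L (S : subsig L) : subsig_le S (full L).
Proof. by []. Qed.

Lemma tp_le L (M : structure L) (S S' : subsig L) (A : params M) X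
    (c : menv M X) :
  subsig_le S S' -> tp S A c `<=` tp S' A c.
Proof. by move=> SS' phi [phiS]; split=> //; exact: formula_in_le phiS. Qed.

(** The same finite cover is kept; each of its members imposes one condition on [S]. *)
Lemma for_large_fork_via L L' (M : structure L') X (dv : pformula M X -> Prop)
    (dv' : subsig L -> pformula M X -> Prop) (P : set (menv M X)) :
  (forall psi, dv psi -> for_large (fun S => dv' S psi)) ->
  fork_via dv P -> for_large (fun S => fork_via (dv' S) P).
Proof.
move=> dvdv' [l [dvl lP]].
have H := for_large_In (Q := fun psi S => dv' S psi)
  (fun psi H => dvdv' _ (dvl psi H)).
by apply: for_large_mono H => S dvS; exists l.
Qed.

Lemma for_large_forks L (M : structure L) (A : params M) X
    (phi : pformula M X) :
  forks (full L) A phi -> for_large (fun S => forks S A phi).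
Proof.
apply: for_large_fork_via => psi [psiS [k [b [bA bk]]]].
have H := for_large_formula_in (finitary_id L) psiS.
apply: for_large_mono H => S psiS'; split=> //; exists k, b; split=> // i theta.
by move/(tp_le (full_max S)); exact: bA.
Qed.

(** * Thorn-dividing *)

Lemma ctx_copies S (car : S -> Type) (Y : seq S) k :
  exists (Z : seq S) (r : 'I_k -> env (var Z) Y),
    forall b : 'I_k -> env car Y, exists v : env car Z,
      forall i, env_ren v (r i) = b i.
Proof.
elim: k => [|k [Z [r rP]]].
  exists [::], (fun i : 'I_0 => False_rect _ (notF (ltn_ord i))) => b.
  by exists (@env_nil _ _) => -[].
exists (Y ++ Z), (fun i => if unlift ord0 i is Some j
  then env_ren (@env_r _ Y Z) (r j) else @env_l _ Y Z) => b.
have [w wE] := rP (fun j => b (lift ord0 j)).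
exists (env_cat (b ord0) w) => i.
by case: unliftP => [j|] ->; [rewrite env_ren_rr wE | rewrite env_ren_l].
Qed.

(** By excluded middle; it admits side conditions such as [i = j] in definable families. *)
Lemma definable_const L (M : structure L) (D : params M) (G : seq (sorts L))
    (P : Prop) :
  definable D (fun _ : menv M G => P).
Proof.
have [HP|HP] := pselect P; last by apply: eq_definable (definable_sat _ Bot).
by apply: eq_definable (definable_True _ _).
Qed.

Lemma definable_env_eq L (M : structure L) (D : params M) (G Y : seq (sorts L))
    (r r' : env (var G) Y) :
  definable D (fun v : menv M G => env_ren v r = env_ren v r').
Proof.
have := definable_all_var (fun s (x : var Y s) =>
  definable_sat D (Eq (Var (r s x)) (Var (r' s x)))).
apply: (eq_definable (M := M)) => v; split=> [|E s x]; first exact: env_ext.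
by move=> /=; transitivity (env_ren v r x) => //; rewrite E.
Qed.

Definition k_inconsistent L (M : structure L) X (psi : pformula M X) k
    (Q : set (menv M (pctx psi))) :=
  forall b : 'I_k -> menv M (pctx psi), injective b -> (forall i, Q (b i)) ->
  ~ exists c : menv M X, forall i, realizes c (PForm (pmat psi) (b i)).

Lemma k_inconsistent_compact (K : universe) L (M : structure L) (D : params M)
    (D' : params (eq_structure M)) (S : subsig (eq_sig L)) X
    (psi : pformula (eq_structure M) X) k :
  monster (full L) K M -> small K D ->
  represents D D' ->
  @k_inconsistent _ _ _ psi k
    (fun b => realizes_type b (tp S D' (ppar psi))) ->
  exists2 l : seq (pformula (eq_structure M) (pctx psi)),
    forall theta, List.In theta l -> tp S D' (ppar psi) theta &
    @k_inconsistent _ _ _ psi k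
      (fun b => forall theta, List.In theta l -> realizes b theta).
Proof.
set q := tp S D' (ppar psi) => MK Dsmall D'D qk; apply: contrapT => nol.
have [Z [r rP]] := @ctx_copies _ (@eq_car L M) (pctx psi) k.
pose G := X ++ Z.
pose r' i : env (var G) (pctx psi) := env_ren (@env_r _ X Z) (r i).
(* [v] codes a tuple [c] and [k] tuples [b i]: these are distinct and [c] satisfies all
   [psi(x, b i)]. *)
pose good (v : menv (eq_structure M) G) :=
  (forall i j, env_ren v (r' i) = env_ren v (r' j) -> i = j) /\
  (forall i, realizes (env_ren v (@env_l _ X Z))
                      (PForm (pmat psi) (env_ren v (r' i)))).
(* Indexing by all formulas, with a vacuous second condition outside [q], keeps the index set a
   plain type; formulas outside [q] are filtered out of finite lists afterwards. *)
pose F theta v :=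
  good v /\ (q theta -> forall i, realizes (env_ren v (r' i)) theta).
have DF theta : definable D' (F theta).
  apply: definable_and.
    apply: definable_and; apply: definable_all_ord => i.
      apply: definable_all_ord => j; apply: definable_imp; last exact: definable_const.
      exact: definable_env_eq.
    have := definable_comp
      (coordinate_map_ren D' (env_cat (@env_l _ X Z) (r' i)))
      (definable_sat D' (pmat psi)).
    by apply: (eq_definable (M := eq_structure M)) => v; rewrite /= env_ren_cat.
  have [qtheta|ntheta] := pselect (q theta); last first.
    by apply: eq_definable (definable_True _ _) => v; split.
  apply: definable_imp; first exact: definable_const.
  apply: definable_all_ord => i.
  apply: (definable_comp (P := fun b => realizes b theta)
    (coordinate_map_ren D' (r' i))).
  by case: qtheta => _ thetaD' _; exists theta.
have [l|v Fv] := eq_saturated MK Dsmall D'D DF.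
  apply: contrapT => nov; apply: nol.
  exists (List.filter (fun theta => `[< q theta >]) l).
    by move=> theta /List.filter_In[_ /asboolP].
  move=> b binj bl [c cb]; apply: nov; have [z zb] := rP b.
  have rb i : env_ren (env_cat c z) (r' i) = b i by rewrite /r' env_ren_rr zb.
  exists (env_cat c z) => theta thetal; split; last first.
    move=> qtheta i; rewrite rb; apply: bl; apply/List.filter_In; split=> //.
    exact/asboolP.
  by split=> [i j|i]; rewrite !rb ?env_ren_l //; exact: binj.
(* Each [F theta] contains [good], so any formula serves here, for instance [Bot]. *)
have [vinj vpsi] := (Fv (PForm (pctx := [::]) Bot (@env_nil _ _))).1.
apply: (qk (fun i => env_ren v (r' i))).
- exact: vinj.
- by move=> i theta qtheta; exact: (Fv theta).2.
- by exists (env_ren v (@env_l _ X Z)).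
Qed.

Lemma for_large_thorn_forks (K : universe) L (M : structure L) (A : params M) X
    (phi : pformula M X) :
  monster (full L) K M -> small K A ->
  thorn_forks (full L) A phi -> for_large (fun S => thorn_forks S A phi).
Proof.
move=> MK Asmall; apply: for_large_fork_via => psi [Z [d [Zfull dpsi]]].
have [d' d'd] := proj_env_surj d.
(* The thorn-dividing parameter [d] may be imaginary; the real tuple [d'] represents it. *)
have D'D : represents (A `|` env_range d') (real_params A `|` env_range d).
  move=> _ [[[t a] Aa ->]|[t [x ->]]] /=.
    exists (@env_single _ (car M) t a) => //.
    by apply: env_range_cons; [left | exact: env_range_nil].
  exists (env_ren d' (block x)); first by rewrite -d'd.
  by move=> _ [s [y ->]]; right; exists s, (block x y).
have Dsmall := small_env_range d' (monster_infinite MK) Asmall.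
have [psiS psina [k kpsi]] := dpsi.
have [l lq lk] := k_inconsistent_compact MK Dsmall D'D kpsi.
have efin := finitary_eq_subsig M.
have H1 := for_large_and (for_large_ctx_in efin Zfull)
                         (for_large_formula_in efin psiS).
have H2 : for_large (fun S => forall theta, List.In theta l ->
    pformula_in (eq_subsig M S) theta).
  apply: for_large_In => theta /lq[thetaS _ _].
  exact: (for_large_formula_in efin thetaS).
have := for_large_and H1 H2; apply: for_large_mono => S [[ZS psiS'] lS].
exists Z, d; split=> //; split=> //.
  (* Nonalgebraicity is a condition on each formula of the type, hence passes to the smaller type.
     Inconsistency survives because the formulas of [l] are still in it. *)
  by move=> theta /(tp_le (eq_subsig_full M S)); exact: psina.
exists k => b binj bS; apply: lk => // i theta thetal; apply: bS.
by have [_ thetaD psitheta] := lq _ thetal; split=> //; exact: lS.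
Qed.

(** * Rank *)

Lemma complete_type_reduct L (M : structure L) (S : subsig L) (A : params M) X
    (p : ptype M X) :
  complete_type (full L) A p -> complete_type S A (type_reduct p S).
Proof.
move=> [pA pfin pcomp]; split=> [phi [/pA[_ Aphi] Sphi] //|l lp|phi Sphi Aphi].
  by apply: pfin => phi /lp[].
have [pphi|pphi] := pcomp phi (formula_in_full _) Aphi; [left | right]; split=> //.
by case: Sphi => GS phiS; split.
Qed.

(** [fk] is abstract so as to cover forking and thorn-forking. Each step of the chain asks two
    things of [S]: that [phi] still forks, and that [phi] is an [S]-formula, so that it survives in
    the reduct of [q]. *)
Lemma for_large_rank_ge L (M : structure L) (K : universe) X
    (fk : subsig L -> params M -> pformula M X -> Prop) :
  (forall A phi, small K A -> fk (full L) A phi ->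
     for_large (fun S => fk S A phi)) ->
  forall n (A : params M) (p : ptype M X), small K A ->
  rank_ge (forking_ext (full L) K (fk (full L))) n (A, p) ->
  for_large (fun S =>
    rank_ge (forking_ext S K (fk S)) n (A, type_reduct p S)).
Proof.
move=> fkP; elim=> [|n IH] A p Asmall /=; first by move=> _; exact: for_largeT.
move=> [[B q] [[AB Bsmall qB pq [phi qphi fkphi]] qn]].
have H1 := for_large_and (fkP _ _ Asmall fkphi)
  (for_large_formula_in (finitary_id L) (formula_in_full (pmat phi))).
have := for_large_and H1 (IH _ _ Bsmall qn).
apply: for_large_mono => S [[fkS phiS] qS].
exists (B, type_reduct q S); split=> //; split=> //.
- exact: complete_type_reduct.
- by move=> theta [/pq].
- by exists phi.
Qed.

Lemma for_large_sufficient L W (Lw : W -> subsig L) (P : subsig L -> Prop) :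
  sufficient Lw -> for_large P ->
  exists w0, forall w, index_lt Lw w0 w -> P (Lw w).
Proof.
move=> Lsuff [S0 /Lsuff[w0 [Ss Sf Sr]] PS]; exists w0 => w [[ws wf wr] _].
by apply: PS; split; [exact: subset_trans ws | exact: subset_trans wf
  | exact: subset_trans wr].
Qed.

Theorem proposition2p12 (LW : signature) (W : Type) (Lw : W -> subsig LW)
    (TW : theory LW)
    (hsuff : sufficient Lw) (hdir : directed Lw) :
  ((forall w, simple_theory (Lw w) (theory_reduct TW (Lw w))) ->
   forall (K : universe) (M : structure LW) (X : seq (sorts LW))
     (A : params M) (p : ptype M X) (n : nat),
     models M TW -> monster (full LW) K M ->
     small K A -> complete_type (full LW) A p ->
     lascar_rank_ge (full LW) K A p n ->
     exists w0, forall w, index_lt Lw w0 w ->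
       lascar_rank_ge (Lw w) K A (type_reduct p (Lw w)) n)
  /\
  ((forall w, rosy_theory (Lw w) (theory_reduct TW (Lw w))) ->
   forall (K : universe) (M : structure LW) (X : seq (sorts LW))
     (A : params M) (p : ptype M X) (n : nat),
     models M TW -> monster (full LW) K M ->
     small K A -> complete_type (full LW) A p ->
     thorn_lascar_rank_ge (full LW) K A p n ->
     exists w0, forall w, index_lt Lw w0 w ->
       thorn_lascar_rank_ge (Lw w) K A (type_reduct p (Lw w)) n).
Proof.
split=> _ K M X A p n _ MK Asmall _ rankp.
  apply: (for_large_sufficient (P := fun S =>
    lascar_rank_ge S K A (type_reduct p S) n)) hsuff _.
  apply: (for_large_rank_ge (fk := fun S A phi => forks S A phi)) rankp => //.
  by move=> B phi _; exact: for_large_forks.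
apply: (for_large_sufficient (P := fun S =>
  thorn_lascar_rank_ge S K A (type_reduct p S) n)) hsuff _.
apply: (for_large_rank_ge (fk := fun S A phi => thorn_forks S A phi)) rankp => //.
by move=> B phi Bsmall; exact: for_large_thorn_forks MK Bsmall.
Qed.
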